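(* Let $n\ge 1$, let $q,t$ be independent indeterminates and work over $\mathbb{Q}(q,t)$. Let $\Lambda_n$, the Macdonald operators $D_k$, the homomorphism $D$, the points $\widehat\lambda$, the Fourier pairing $\langle g,f\rangle=[D(g)\cdot f](\widehat 0)$, the interpolation polynomials $I_\mu$, the Macdonald polynomials $P_\mu$ and the coefficients $c_{\mu,\nu}$ be as in the context. Then for all partitions $\mu,\nu$ with at most $n$ parts, $$\langle I_\mu,I_\nu\rangle=\delta_{\mu,\nu}\,I_\mu(\widehat\mu)\,P_\mu(\widehat 0)=\delta_{\mu,\nu}\,c_{\mu,\mu}\,I_\mu(\widehat\mu).$$
   Context: $\Lambda_n$ is the algebra of symmetric polynomials in $x_1,\dots,x_n$. For $k=1,\dots,n$, $D_k=t^{k(k-1)/2}\sum_{|S|=k}\prod_{i\in S,j\notin S}\frac{tx_i-x_j}{x_i-x_j}\prod_{i\in S}T_i$, the sum over $k$-subsets $S\subset\{1,\dots,n\}$, with $[T_if](x)=f(x_1,\dots,qx_i,\dots,x_n)$. These commute and preserve $\Lambda_n$, and $D:\Lambda_n\to\operatorname{End}(\Lambda_n)$ is the algebra homomorphism with $D(e_k)=D_k$ ($e_k$ the elementary symmetric polynomials). For a partition $\lambda$ with at most $n$ parts, $\widehat\lambda=(q^{\lambda_1}t^{n-1},q^{\lambda_2}t^{n-2},\dots,q^{\lambda_n})$, so $\widehat 0=(t^{n-1},\dots,t,1)$. $m_\lambda$ is the monomial symmetric polynomial; $\le$ is dominance order ($\mu\le\lambda$ iff all partial sums of $\mu$ are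 at most those of $\lambda$ and $|\mu|=|\lambda|$). The Macdonald polynomial $P_\lambda$ is the unique element of $\Lambda_n$ with $D_kP_\lambda=e_k(\widehat\lambda)P_\lambda$ for all $k$ and $P_\lambda=m_\lambda+\sum_{\mu<\lambda}b_\mu m_\mu$. Fix a total order $\vartriangleleft$ on partitions with at most $n$ parts compatible with size and, within a given size, with dominance; $I_\mu$ is the unique element of $\Lambda_n$ with $I_\mu=m_\mu+\sum_{\lambda\vartriangleleft\mu}a_\lambda m_\lambda$ and $I_\mu(\widehat\lambda)=0$ for all $\lambda\vartriangleleft\mu$. For a partition $\mu$ with at most $n$ parts let $\mu'$ be its conjugate partition and $D_\mu=D_{\mu'_1}D_{\mu'_2}\cdots D_{\mu'_{\mu_1}}$ (all $\mu'_j\le n$). The scalars $c_{\mu,\nu}\in\mathbb{Q}(q,t)$ are the (uniquely determined) coefficients such that for every $f\in\Lambda_n$, $[D_\mu\cdot f](\widehat 0)=\sum_{\nu\le\mu}c_{\mu,\nu}\,f(\widehat\nu)$, the sum over partitions $\nu$ with at most $n$ parts. *)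

(* Defs.v *)
From HB Require Import structures.
From mathcomp Require Import all_boot all_order all_algebra all_fingroup.
From mathcomp Require Import fraction.
From mathcomp Require Import mpoly.
From Stdlib Require Import ClassicalEpsilon.

Set Implicit Arguments. Unset Strict Implicit. Unset Printing Implicit Defensive.
Import Order.TTheory GRing.Theory Num.Theory.
Local Open Scope ring_scope.

Definition Kqt : fieldType := {fraction {poly {poly rat}}}.
Definition qq : Kqt := tofrac (('X : {poly rat})%:P).
Definition tt : Kqt := tofrac ('X : {poly {poly rat}}).

Definition is_partition n (m : 'X_{1..n}) : bool :=
  [forall i : 'I_n, forall j : 'I_n, (i <= j)%N ==> (m j <= m i)%N].

Definition dominated n (mu la : 'X_{1..n}) : bool :=
  (mdeg mu == mdeg la) &&
  [forall k : 'I_n.+1,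
     (\sum_(i < n | (i < k)%N) mu i <= \sum_(i < n | (i < k)%N) la i)%N].

Definition monsym n (la : 'X_{1..n}) : {mpoly Kqt[n]} :=
  \sum_(a : 'X_{1..n < (mdeg la).+1}
         | perm_eq (multinom_val (bmnm a)) (multinom_val la)) 'X_[bmnm a].

Definition hat n (la : 'X_{1..n}) : 'I_n -> Kqt :=
  fun i => qq ^+ (la i) * tt ^+ (n - i.+1).

Definition hat0 n : 'I_n -> Kqt := hat (0%MM : 'X_{1..n}).

Definition Tshift n (S : {set 'I_n}) (f : {mpoly Kqt[n]}) : {mpoly Kqt[n]} :=
  f \mPo [tuple (if j \in S then qq *: 'X_j else 'X_j) | j < n].

Definition DkF n (k : nat) (f : {mpoly Kqt[n]}) : {fraction {mpoly Kqt[n]}} :=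
  tofrac ((tt ^+ ((k * (k - 1)) %/ 2))%:MP) *
  \sum_(S : {set 'I_n} | #|S| == k)
     ((\prod_(i in S) \prod_(j in ~: S)
         (tofrac (tt *: 'X_i - 'X_j) / tofrac ('X_i - 'X_j)))
      * tofrac (Tshift S f)).

(* Macdonald operator D_k: the polynomial equal to the above rational
   function (it exists whenever f is symmetric; 0 otherwise). *)
Definition Dop n (k : nat) (f : {mpoly Kqt[n]}) : {mpoly Kqt[n]} :=
  epsilon (inhabits 0) (fun p : {mpoly Kqt[n]} => tofrac p = DkF k f).

Definition conjp n (mu : 'X_{1..n}) (j : nat) : nat :=
  #|[set i : 'I_n | (j <= mu i)%N]|.

Definition Dmu n (mu : 'X_{1..n}) (f : {mpoly Kqt[n]}) : {mpoly Kqt[n]} :=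
  foldr (fun j g => Dop (conjp mu j) g) f (iota 1 (\max_(i < n) mu i)).

(* Main.v *)
(* Both families e_{mu'} := prod_j e_{mu'_j} and P_mu are unitriangular in the
   monomial symmetric polynomials for the order, as are the I_mu; hence I_mu
   equals e_{mu'} (resp. P_mu) plus a combination of the e_{la'} (resp. P_la)
   with la strictly below mu.
   Pairing: <e_{la'}, f> = [D_la f](hat 0) only involves the values f(hat ka)
   with ka dominated by la, so <e_{la'}, I_nu> = 0 for la below nu; and
   D(g) P_la = g(hat la) P_la, so <I_mu, P_la> = I_mu(hat la) P_la(hat 0) = 0
   for la below mu. Expanding I_mu in the e_{la'} kills <I_mu, I_nu> for mu
   below nu, expanding I_nu in the P_la kills it for nu below mu, and for
   mu = nu the two expansions leave c_{mu,mu} I_mu(hat mu) and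
   I_mu(hat mu) P_mu(hat 0) respectively.
   That D_k preserves symmetric polynomials: the Vandermonde determinant times
   D_k f is an antisymmetric polynomial, and an antisymmetric polynomial
   vanishes on every hyperplane X_i = X_j, hence is a multiple of the
   Vandermonde determinant. *)
Require Import Defs.
From HB Require Import structures.
From mathcomp Require Import all_boot all_order all_algebra all_fingroup.
From mathcomp Require Import fraction.
From mathcomp Require Import mpoly.
From Stdlib Require Import ClassicalEpsilon.
Import Order.TTheory GRing.Theory Num.Theory.
Local Open Scope ring_scope.
Set Implicit Arguments. Unset Strict Implicit. Unset Printing Implicit Defensive.

(** * Antisymmetric polynomials and divisibility by the Vandermonde determinant *)

Section Antisymmetric.
Variables (n : nat) (R : idomainType).
Implicit Types (p : {mpoly R[n]}) (i j : 'I_n).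

Lemma mpolyXU_inj : injective (fun i => 'X_i : {mpoly R[n]}).
Proof.
move=> i j /(congr1 (mcoeff U_(j))); rewrite !mcoeffXU eqxx.
by case: eqP => // _ /eqP; rewrite eq_sym oner_eq0.
Qed.

Lemma msymXU (s : 'S_n) i : msym s 'X_i = 'X_(s i) :> {mpoly R[n]}.
Proof. by rewrite /msym mmapX mmap1U. Qed.

Lemma msym_comp (s : 'S_n) p (T : n.-tuple {mpoly R[n]}) :
  msym s (p \mPo T) = p \mPo [tuple msym s (tnth T i) | i < n].
Proof.
rewrite !comp_mpolyEX raddf_sum; apply: eq_bigr => m _ /=.
rewrite msymZ !comp_mpolyX rmorph_prod; congr (_ *: _).
by apply: eq_bigr => i _; rewrite rmorphXn /= tnth_mktuple.
Qed.

(** Restriction to the hyperplane X_i = X_j, kept inside the same polynomial ring. *)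
Definition collapse i j p := p \mPo [tuple if k == i then 'X_j else 'X_k | k < n].

Lemma collapseXU i j k : collapse i j 'X_k = 'X_(if k == i then j else k).
Proof. by rewrite /collapse comp_mpolyXU -tnth_nth tnth_mktuple; case: eqP. Qed.

(** The polynomials with this property contain the variables and are closed under products and
    linear combinations. *)
Lemma collapse_dvd i j p : exists r, p = collapse i j p + ('X_i - 'X_j) * r.
Proof.
pose Q p := exists r, p = collapse i j p + ('X_i - 'X_j) * r.
have QM p1 p2 : Q p1 -> Q p2 -> Q (p1 * p2).
  move=> [r1 e1] [r2 e2]; rewrite /Q /collapse rmorphM /= -!/(collapse i j _).
  exists (r1 * p2 + collapse i j p1 * r2).
  rewrite mulrDr {1}e1 mulrDl {1}e2 mulrDr mulrA addrAC -!addrA !mulrA.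
  by rewrite (mulrC (collapse i j p1) (_ - _)).
have Q1 : Q 1 by exists 0; rewrite /collapse rmorph1 mulr0 addr0.
have QX k : Q 'X_k.
  rewrite /Q collapseXU; case: eqP => [->|_]; last by exists 0; rewrite mulr0 addr0.
  by exists 1; rewrite mulr1 addrC subrK.
rewrite -/(Q p); elim/mpolyind: p => [|c m p _ _ [r e]].
  by exists 0; rewrite /collapse raddf0 mulr0 addr0.
have [r' e'] : Q 'X_[m].
  rewrite mpolyXE_id; apply: (big_ind Q) => // k _.
  by elim: (m k) => [|d IH]; rewrite ?expr0 // exprS; apply: QM.
exists (c *: r' + r); rewrite /collapse raddfD /= comp_mpolyZ -!/(collapse i j _).
by rewrite {1}e {1}e' scalerDr mulrDr -scalerAr addrACA.
Qed.

(** Linear factors are split off one at a time. The conditions on [s] make every factor nonzero and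
    exclude repetitions, even up to sign. So no other factor vanishes on X_i = X_j, and in a domain
    the cofactor must vanish there. *)
Lemma collapse_prod_dvd (s : seq ('I_n * 'I_n)) p :
    uniq s -> {in s, forall ij, (ij.2, ij.1) \notin s} ->
    {in s, forall ij, collapse ij.1 ij.2 p = 0} ->
  exists r, p = (\prod_(ij <- s) ('X_(ij.1) - 'X_(ij.2))) * r.
Proof.
elim: s => [|[i j] s IH] /=; first by exists p; rewrite big_nil mul1r.
move=> /andP[ijs us] asy col.
have [|| r e] := IH us.
- by move=> ab abs; have := asy ab; rewrite !inE abs orbT negb_or => /(_ isT)/andP[].
- by move=> ab abs; apply: col; rewrite inE abs orbT.
have := col (i, j); rewrite inE eqxx e /= => /(_ isT).
rewrite /collapse rmorphM /= rmorph_prod /= => /eqP.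
rewrite mulf_eq0 prodf_seq_eq0 => /orP[/hasP[[a b] abs /=]|/eqP r0]; last first.
  have [r' e'] := collapse_dvd i j r.
  by exists r'; rewrite e' /collapse r0 add0r big_cons mulrCA mulrA.
(* If a later factor vanished, [a] and [b] would agree once [i] becomes [j]. Then (a, b) is (i, j),
   against uniqueness, or (j, i) or a diagonal pair, against asymmetry. *)
rewrite raddfB /= -!/(collapse i j _) !collapseXU subr_eq0 => /eqP/mpolyXU_inj eab.
exfalso; have := asy (a, b); rewrite !inE abs orbT /= => /(_ isT).
have := asy (i, j); rewrite !inE eqxx /= => /(_ isT).
rewrite negb_or => /andP[nij ns]; rewrite negb_or !xpair_eqE => /andP[n1 n2].
move: eab n1 n2 ijs ns abs; rewrite xpair_eqE in nij *.
case: eqP => [->|nai]; case: eqP => [->|nbi]; rewrite ?eqxx /=.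
- by move=> _ _ /negP h1 _ _ /h1.
- by move=> -> _ _ /negP h _ /h.
- by move=> -> _ _ _ /negP h /h.
- by move=> -> _ /negP h _ _ /h.
Qed.

(** The transposition acts trivially on the hyperplane, so the restriction of [p] equals its own
    negative. *)
Lemma collapse_antisym i j p :
  (2%:R : R) != 0 -> msym (tperm i j) p = - p -> collapse i j p = 0.
Proof.
move=> two /(congr1 (collapse i j)); rewrite /collapse msym_mPo raddfN /=.
have -> : [tuple tnth [tuple if k == i then 'X_j else 'X_k | k < n] (tperm i j k) | k < n]
    = [tuple if k == i then 'X_j else 'X_k | k < n] :> n.-tuple {mpoly R[n]}.
  apply: eq_from_tnth => k; rewrite !tnth_mktuple.
  case: tpermP => [->|->|/eqP/negPf ni _]; last by rewrite ni.
  - by rewrite eqxx; case: eqP.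
  - by rewrite eqxx; case: eqP.
move/eqP; rewrite -addr_eq0 -mulr2n -mulr_natl -mpolyC_nat mulf_eq0 mpolyC_eq0.
by rewrite (negPf two) => /eqP.
Qed.

Definition mvand : {mpoly R[n]} := \det (Vandermonde n (\row_k 'X_k)).

Lemma mvandE :
  mvand = \prod_(ij <- [seq ij : 'I_n * 'I_n <- index_enum _ | (ij.2 < ij.1)%N])
             ('X_(ij.1) - 'X_(ij.2)).
Proof.
rewrite /mvand det_Vandermonde big_filter.
rewrite (exchange_big_dep xpredT) //= pair_big_dep /=.
by apply: eq_bigr => -[a b] _; rewrite !mxE.
Qed.

Lemma mvand_neq0 : mvand != 0.
Proof.
rewrite mvandE prodf_seq_neq0; apply/allP => -[a b]; rewrite mem_filter /= => /andP[ab _].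
rewrite subr_eq0; apply/negP => /eqP/mpolyXU_inj eab.
by rewrite eab ltnn in ab.
Qed.

(** Renaming the variables permutes the columns of the Vandermonde matrix. *)
Lemma msym_mvand s : msym s mvand = (-1) ^+ s * mvand.
Proof.
rewrite /mvand -det_map_mx -odd_permV -(@det_perm {mpoly R[n]}) mulrC -det_mulmx.
rewrite -col_permE; congr (\det _).
by apply/matrixP => a b; rewrite !mxE rmorphXn /= msymXU.
Qed.

Lemma antisym_mvand_dvd p : (2%:R : R) != 0 ->
  (forall s : 'S_n, msym s p = (-1) ^+ s * p) -> exists r, p = mvand * r.
Proof.
move=> two anti; rewrite mvandE; apply: collapse_prod_dvd.
- by rewrite filter_uniq // index_enum_uniq.
- move=> [a b]; rewrite !mem_filter /= => /andP[ab _].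
  by rewrite negb_and -leqNgt (ltnW ab).
- move=> [a b]; rewrite mem_filter /= => /andP[ab _].
  apply: collapse_antisym => //; rewrite anti odd_tperm.
  by rewrite -val_eqE /= (gtn_eqF ab) expr1 mulN1r.
Qed.

(** Used to clear the denominator of the term of [S] in a Macdonald operator. The determinant
    changes sign under each transposition exchanging an element of [S] with one outside, so it
    vanishes on all these hyperplanes. *)
Lemma mvand_split (S : {set 'I_n}) : (2%:R : R) != 0 ->
  exists v, mvand = (\prod_(i in S) \prod_(j in ~: S) ('X_i - 'X_j)) * v.
Proof.
move=> two.
have [||| v ->] := @collapse_prod_dvd
   [seq ij : 'I_n * 'I_n <- index_enum _ | (ij.1 \in S) && (ij.2 \in ~: S)] mvand.
- by rewrite filter_uniq // index_enum_uniq.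
- move=> [a b]; rewrite !mem_filter !inE /= => /andP[/andP[aS bS] _].
  by rewrite (negPf bS).
- move=> [a b]; rewrite mem_filter !inE /= => /andP[/andP[aS bS] _].
  apply: collapse_antisym => //; rewrite msym_mvand odd_tperm.
  by case: eqP bS => [<-|_ _]; rewrite ?aS // expr1 mulN1r.
by exists v; rewrite big_filter pair_big_dep.
Qed.

End Antisymmetric.

(** * Macdonald operators over a field: polynomial symmetric values, linearity *)

Lemma Kqt_two_neq0 : (2%:R : Kqt) != 0.
Proof.
rewrite -[2%:R](rmorph_nat (@tofrac {poly {poly rat}})) tofrac_eq0.
by rewrite -[2%:R](rmorph_nat polyC) polyC_eq0 -[2%:R](rmorph_nat polyC) polyC_eq0.
Qed.

Section MacdonaldOperator.
Variables (n : nat) (K : fieldType) (q t : K).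
Hypothesis two_neq0 : (2%:R : K) != 0.
Implicit Types (f g : {mpoly K[n]}) (S : {set 'I_n}) (s : 'S_n).

Definition qshift S f :=
  f \mPo [tuple (if j \in S then q *: 'X_j else 'X_j) | j < n].

Definition macdonald_frac (c : K) (k : nat) f : {fraction {mpoly K[n]}} :=
  tofrac c%:MP * \sum_(S : {set 'I_n} | #|S| == k)
     ((\prod_(i in S) \prod_(j in ~: S)
         (tofrac (t *: 'X_i - 'X_j) / tofrac ('X_i - 'X_j)))
      * tofrac (qshift S f)).

Lemma msym_qshift s S f : f \is symmetric ->
  msym s (qshift S f) = qshift (s @: S) f.
Proof.
move=> /issymP symf; rewrite /qshift -[in RHS](symf s) msym_mPo msym_comp.
congr (_ \mPo _); apply: eq_from_tnth => i; rewrite !tnth_mktuple.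
by rewrite mem_imset; [case: ifP; rewrite ?msymZ msymXU|exact: perm_inj].
Qed.

Lemma macdonald_frac_sym_mpoly c k f : f \is symmetric ->
  exists2 p : {mpoly K[n]}, p \is symmetric & tofrac p = macdonald_frac c k f.
Proof.
move=> symf.
pose d S : {mpoly K[n]} := \prod_(i in S) \prod_(j in ~: S) ('X_i - 'X_j).
pose a S : {mpoly K[n]} := \prod_(i in S) \prod_(j in ~: S) (t *: 'X_i - 'X_j).
(* [v S] is the quotient of the Vandermonde determinant by the denominator of the term of [S]. *)
have [v vP] : exists v, forall S, mvand n K = d S * v S.
  apply: (fin_all_exists (P := fun S u => mvand n K = d S * u)) => S.
  by have [v] := mvand_split S two_neq0; exists v.
have d0 S : d S != 0.
  by apply: contraNneq (mvand_neq0 n K) => dS; rewrite (vP S) dS mul0r.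
(* The scalar [u] covers both the numerators ([u = t]) and the denominators ([u = 1]). *)
have msym_cross s (u : K) S : msym s (\prod_(i in S) \prod_(j in ~: S) (u *: 'X_i - 'X_j))
    = \prod_(i in s @: S) \prod_(j in ~: (s @: S)) (u *: 'X_i - 'X_j).
  rewrite rmorph_prod big_imset /=; last by move=> ? ? _ _; exact: perm_inj.
  apply: eq_bigr => i _; rewrite rmorph_prod /=.
  have -> : ~: (s @: S) = s @: (~: S).
    by apply/setP => x; rewrite -[x](permKV s) inE !(mem_imset _ _ perm_inj) inE.
  rewrite big_imset /=; last by move=> ? ? _ _; exact: perm_inj.
  by apply: eq_bigr => j _; rewrite raddfB /= msymZ !msymXU.
have msym_d s S : msym s (d S) = d (s @: S).
  have := msym_cross s 1 S.
  by under eq_bigr => i _ do under eq_bigr => j _ do rewrite scale1r;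
     under [X in _ = X -> _]eq_bigr => i _ do under eq_bigr => j _ do rewrite scale1r.
have msym_v s S : msym s (v S) = (-1) ^+ s * v (s @: S).
  apply: (mulfI (d0 (s @: S))); rewrite -msym_d -rmorphM /= -vP msym_mvand.
  by rewrite (vP (s @: S)) msym_d mulrCA.
(* The Vandermonde determinant times the operator's sum over [S], written without denominators. *)
pose N : {mpoly K[n]} := \sum_(S : {set 'I_n} | #|S| == k) v S * (a S * qshift S f).
have msym_N s : msym s N = (-1) ^+ s * N.
  (* The permutation carries the term of [S] to that of [s @: S], up to the sign, and permutes the
     subsets of size [k]. *)
  rewrite raddf_sum mulr_sumr [RHS](reindex_inj (imset_inj (@perm_inj _ s))) /=.
  apply: eq_big => [S|S _]; first by rewrite card_imset //; exact: perm_inj.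
  by rewrite !msymM msym_v msym_cross msym_qshift // -!mulrA.
have [p Np] := antisym_mvand_dvd two_neq0 msym_N.
have symp : p \is symmetric.
  apply/issymP => s; apply: (mulfI (mvand_neq0 n K)); rewrite -Np.
  have := msym_N s; rewrite Np msymM msym_mvand -mulrA => /(congr1 ( *%R ((-1) ^+ s))).
  by rewrite !mulrA -expr2 sqrr_sign !mul1r.
exists (c%:MP * p).
  by rewrite mul_mpolyC rpredZ.
rewrite /macdonald_frac tofracM; congr (_ * _).
have V0 : tofrac (mvand n K) != 0 by rewrite tofrac_eq0 mvand_neq0.
apply: (mulfI V0); rewrite -tofracM -Np raddf_sum mulr_sumr.
apply: eq_bigr => S _; rewrite /= !tofracM mulrA [RHS]mulrA; congr (_ * _).
have -> : \prod_(i in S) \prod_(j in ~: S) (tofrac (t *: 'X_i - 'X_j) / tofrac ('X_i - 'X_j))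
   = tofrac (a S) / tofrac (d S).
  rewrite !rmorph_prod -prodf_div; apply: eq_bigr => i _.
  by rewrite /= !rmorph_prod -prodf_div.
have D0 : tofrac (d S) != 0 by rewrite tofrac_eq0 d0.
rewrite (vP S) tofracM.
move: D0; move: (tofrac (d S)) (tofrac (a S)) (tofrac (v S)) => x y z x0.
rewrite [x * z]mulrC mulrACA.
by rewrite divff ?mulr1.
Qed.

Lemma macdonald_frac_linear c k (u : K) f g :
  macdonald_frac c k (u *: f + g)
  = tofrac u%:MP * macdonald_frac c k f + macdonald_frac c k g.
Proof.
rewrite /macdonald_frac mulrCA -mulrDr; congr (_ * _); rewrite mulr_sumr -big_split /=.
apply: eq_bigr => S _; rewrite mulrCA -mulrDr; congr (_ * _).
by rewrite -tofracM -tofracD /qshift mul_mpolyC raddfD /= comp_mpolyZ.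
Qed.

End MacdonaldOperator.

(** * The operators [Dop] on symmetric polynomials *)

Section MacdonaldDop.
Variable n : nat.
Implicit Types (f g : {mpoly Kqt[n]}).

Lemma DkFE k f : DkF k f = macdonald_frac qq tt (tt ^+ ((k * (k - 1)) %/ 2)) k f.
Proof. by []. Qed.

Lemma DkF_sym_mpoly k f : f \is symmetric ->
  exists2 p : {mpoly Kqt[n]}, p \is symmetric & tofrac p = DkF k f.
Proof. by move=> symf; rewrite DkFE; exact: (macdonald_frac_sym_mpoly _ _ Kqt_two_neq0). Qed.

(** The polynomial just obtained is a witness, so the choice made by [epsilon] satisfies its
    specification. *)
Lemma DopE k f : f \is symmetric -> tofrac (Dop k f) = DkF k f.
Proof.
move=> /(DkF_sym_mpoly k)[p _ pE].
exact: (epsilon_spec _ (fun p => tofrac p = DkF k f) (ex_intro _ p pE)).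
Qed.

Lemma Dop_sym k f : f \is symmetric -> Dop k f \is symmetric.
Proof.
move=> symf; have [p symp pE] := DkF_sym_mpoly k symf.
suff -> : Dop k f = p by [].
by apply/eqP; rewrite -tofrac_eq; apply/eqP; rewrite pE DopE.
Qed.

Lemma Dop_linear k (c : Kqt) f g : f \is symmetric -> g \is symmetric ->
  Dop k (c *: f + g) = c *: Dop k f + Dop k g.
Proof.
move=> symf symg; apply/eqP; rewrite -tofrac_eq; apply/eqP.
have symfg : c *: f + g \is symmetric by apply: rpredD => //; exact: rpredZ.
rewrite (DopE k symfg) DkFE macdonald_frac_linear -!DkFE.
by rewrite -(DopE k symf) -(DopE k symg) -tofracM -tofracD mul_mpolyC.
Qed.

End MacdonaldDop.

(** * Monomial symmetric polynomials span the symmetric polynomials *)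

Section MonomialSymmetric.
Variable n : nat.
Implicit Types (m la mu : 'X_{1..n}).

Lemma mnm_perm_eqP m la :
  reflect (exists s : 'S_n, m = [multinom la (s i) | i < n])
          (perm_eq (multinom_val m) (multinom_val la)).
Proof.
apply: (iffP tuple_permP) => -[s e]; exists s; last by rewrite e.
by apply/val_inj/val_inj.
Qed.

Lemma is_partitionE m : is_partition m = sorted geq (multinom_val m).
Proof.
have geq_trans : transitive geq by move=> a b c /= ba cb; exact: leq_trans cb ba.
apply/idP/idP => [/forallP pm|sm].
  rewrite sorted_pairwise //; apply/(pairwiseP 0%N) => i j.
  rewrite !inE size_tuple => ltin ltjn ltij.
  have /forallP/(_ (Ordinal ltjn)) := pm (Ordinal ltin).
  by rewrite /= (ltnW ltij) /= !(mnm_nth 0%N).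
apply/forallP => i; apply/forallP => j; apply/implyP => leij.
rewrite !(mnm_nth 0%N); apply: (sorted_leq_nth geq_trans _ 0%N sm) => //.
- by move=> x /=.
- by rewrite inE size_tuple.
- by rewrite inE size_tuple.
Qed.

(** The unique partition in the orbit of [m] under permutation of the exponents. *)
Definition mnm_sort m : 'X_{1..n} := Multinom (sort_tuple geq (multinom_val m)).

Lemma perm_mnm_sort m :
  perm_eq (multinom_val m) (multinom_val (mnm_sort m)).
Proof. by rewrite perm_sym; exact/permPl/perm_sort. Qed.

Lemma mnm_sort_partition m : is_partition (mnm_sort m).
Proof. by rewrite is_partitionE; apply: sort_sorted => a b; exact: leq_total. Qed.

Lemma partition_perm_eq m la : is_partition la ->
  perm_eq (multinom_val m) (multinom_val la) = (la == mnm_sort m).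
Proof.
move=> pla; apply/idP/eqP => [mla|->]; last exact: perm_mnm_sort.
apply/val_inj/val_inj; apply: (@sorted_eq _ geq).
- by move=> a b c /= ba cb; exact: leq_trans cb ba.
- by move=> a b; rewrite andbC -eqn_leq => /eqP.
- by rewrite -is_partitionE.
- by rewrite -is_partitionE mnm_sort_partition.
- by rewrite perm_sym (perm_trans _ mla) // perm_sym perm_mnm_sort.
Qed.

Lemma mdeg_perm m la :
  perm_eq (multinom_val m) (multinom_val la) -> mdeg m = mdeg la.
Proof. exact: perm_big. Qed.

Lemma mcoeff_monsym m la :
  (monsym la)@_m = (perm_eq (multinom_val m) (multinom_val la))%:R.
Proof.
rewrite /monsym raddf_sum /=; under eq_bigr do rewrite mcoeffX.
have [mla|nmla] := boolP (perm_eq _ _).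
  have lt_m : (mdeg m < (mdeg la).+1)%N by rewrite (mdeg_perm mla).
  rewrite (bigD1 (BMultinom lt_m)) //= eqxx big1 ?addr0 // => a /andP[_].
  by rewrite -val_eqE /= => /negPf ->.
rewrite big1 // => a ala; case: eqP => // am.
by rewrite -am ala in nmla.
Qed.

Lemma monsym_sym la : monsym la \is symmetric.
Proof.
apply/issymP => s; apply/mpolyP => m; rewrite mcoeff_sym !mcoeff_monsym.
have /permPl -> // : perm_eq (multinom_val [multinom m (s i) | i < n]) (multinom_val m).
by apply/mnm_perm_eqP; exists s.
Qed.

(** Coefficients of a symmetric polynomial are constant on orbits of exponents, and each orbit
    contains exactly one partition. *)
Lemma sym_monsymE (f : {mpoly Kqt[n]}) k : f \is symmetric -> (msize f <= k)%N ->
  f = \sum_(la : 'X_{1..n < k} | is_partition la) f@_la *: monsym la.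
Proof.
move=> symf szf; apply/mpolyP => m; rewrite raddf_sum /=.
under eq_bigr => la pla do rewrite mcoeffZ mcoeff_monsym (partition_perm_eq _ pla).
have dm := mdeg_perm (perm_mnm_sort m).
have fm : f@_m = f@_(mnm_sort m).
  by have /mnm_perm_eqP[s {1}->] := perm_mnm_sort m; rewrite msym_coeff.
have [lt_m|ge_m] := ltnP (mdeg (mnm_sort m)) k.
  rewrite (bigD1 (BMultinom lt_m)) /= ?mnm_sort_partition // eqxx mulr1 -fm.
  rewrite big1 ?addr0 // => la /andP[_]; rewrite -val_eqE /= => /negPf ->.
  by rewrite mulr0.
rewrite big1 => [|la _].
  by apply/eqP; rewrite mcoeff_eq0 msize_mdeg_ge // dm (leq_trans szf).
case: eqP => [e|_]; last by rewrite mulr0.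
by have := bmdeg la; rewrite e ltnNge ge_m.
Qed.

End MonomialSymmetric.

(** * Products of elementary symmetric polynomials and dominance *)

Section ElementaryProducts.
Variable n : nat.
Implicit Types (m la mu : 'X_{1..n}).

(** For j at least 1, the j-th column of the Young diagram, as a set of row indices. *)
Definition level mu (j : nat) : {set 'I_n} := [set i | (j <= mu i)%N].

Definition maxpart mu : nat := \max_(i < n) mu i.

Definition conj_mesym (R : comNzRingType) mu : {mpoly R[n]} :=
  \prod_(j <- iota 1 (maxpart mu)) mesym n R (conjp mu j).

Lemma card_ord_lt k : (k <= n)%N -> #|[set i : 'I_n | (i < k)%N]| = k.
Proof.
move=> lekn; rewrite -sum1_card; under eq_bigl do rewrite inE.
by rewrite -(big_ord_widen _ (fun=> 1%N) lekn) sum1_card card_ord.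
Qed.

Lemma partition_level mu : is_partition mu ->
  forall (i a : 'I_n) j, (a <= i)%N -> i \in level mu j -> a \in level mu j.
Proof.
move=> /forallP pmu i a j leai; rewrite !inE => /leq_trans; apply.
by have /forallP/(_ i)/implyP := pmu a; apply.
Qed.

(** A column of a partition is closed downwards, hence is the initial segment of its size. *)
Lemma mem_level mu j (i : 'I_n) : is_partition mu ->
  (i \in level mu j) = (i < conjp mu j)%N.
Proof.
move=> pmu; rewrite /conjp -/(level mu j); apply/idP/idP => [il|].
  rewrite -(card_ord_lt (ltn_ord i)); apply: subset_leq_card.
  by apply/subsetP => a; rewrite inE ltnS => /partition_level; apply.
apply: contraLR => il; rewrite -leqNgt -[leqRHS](card_ord_lt (ltnW (ltn_ord i))).
apply: subset_leq_card; apply/subsetP => a al; rewrite inE ltnNge.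
by apply: contra il => leia; exact: partition_level al.
Qed.

(** The cells lying in the rows of [P] are counted by rows, then by columns. *)
Lemma sum_level mu (P : pred 'I_n) :
  (\sum_(i < n | P i) mu i = \sum_(j <- iota 1 (maxpart mu)) #|[set i in level mu j | P i]|)%N.
Proof.
under [RHS]eq_bigr => j _ do rewrite -sum1_card.
rewrite (exchange_big_dep P) /=; last by move=> j i _; rewrite !inE => /andP[].
apply: eq_bigr => i Pi; under eq_bigl => j do rewrite !inE Pi andbT.
have le_i : (mu i <= maxpart mu)%N by exact: leq_bigmax.
rewrite sum1_count -(subnKC le_i) iotaD count_cat.
rewrite (eq_in_count (a2 := predT)) => [|j]; last by rewrite mem_iota add1n ltnS => /andP[].
rewrite count_predT size_iota (eq_in_count (a2 := pred0)) ?count_pred0 ?addn0 // => j.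
by rewrite mem_iota add1n => /andP[lt_j _]; rewrite leqNgt lt_j.
Qed.

(** Either the column contains every index below [k], or it lies entirely among them; both ways no
    set of its size does better. *)
Lemma card_level_max mu j (h : {set 'I_n}) k : is_partition mu -> #|h| = conjp mu j ->
  (#|[set i in h | (i < k)%N]| <= #|[set i in level mu j | (i < k)%N]|)%N.
Proof.
move=> pmu ch.
have [sub|/subsetPn[i0]] := boolP ([set i : 'I_n | (i < k)%N] \subset level mu j).
  apply: subset_leq_card; apply/subsetP => i; rewrite inE => /andP[_ ik].
  by rewrite inE ik (subsetP sub) // inE.
rewrite inE => lt_i0 nl; apply: (@leq_trans #|h|).
  by apply: subset_leq_card; apply/subsetP => i; rewrite inE => /andP[].
rewrite ch; apply: subset_leq_card; apply/subsetP => i il; rewrite !inE.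
have -> : (j <= mu i)%N by rewrite inE in il.
apply: leq_ltn_trans lt_i0; rewrite leqNgt; apply: contra nl => lt_i.
by apply: (partition_level pmu (ltnW lt_i)); rewrite inE in il *.
Qed.

(** A monomial of the product picks, for each column, a set of rows of the same size;
    [card_level_max] bounds the partial sums column by column. *)
Lemma msupp_conj_mesym (R : comNzRingType) mu m : is_partition mu ->
  m \in msupp (conj_mesym R mu) -> dominated m mu.
Proof.
move=> pmu; rewrite /conj_mesym => mE.
suff H (s : seq nat) : m \in msupp (\prod_(j <- s) mesym n R (conjp mu j)) ->
    mdeg m = (\sum_(j <- s) #|level mu j|)%N /\ forall k,
    (\sum_(i < n | (i < k)%N) m i <= \sum_(j <- s) #|[set i in level mu j | (i < k)%N]|)%N.
  have [dm lm] := H _ mE; apply/andP; split.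
    rewrite dm mdegE (sum_level mu predT); apply/eqP; apply: eq_bigr => j _.
    by apply: eq_card => i; rewrite !inE andbT.
  by apply/forallP => k; rewrite (sum_level mu).
elim: s m {mE} => [|j s IH] m.
  rewrite !big_nil msupp1 inE => /eqP ->; split=> [|k]; first by rewrite mdeg0.
  by rewrite big_nil big1 // => i _; rewrite mnm0E.
rewrite big_cons => /msuppM_le/allpairsP[[m1 m2] /= [m1s m2s ->]].
have [d2 l2] := IH _ m2s.
move: m1s; rewrite msupp_mesymP => /existsP[h /andP[/eqP ch /eqP ->]].
split=> [|k]; first by rewrite mdegD mdeg_mesym1 ch d2 big_cons.
rewrite big_cons; under eq_bigr do rewrite mnmDE.
rewrite big_split /= leq_add // (leq_trans _ (card_level_max k pmu ch)) //.
rewrite -sum1_card big_mkcond [leqRHS]big_mkcond /= leq_sum // => i _.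
by rewrite mnmE !inE; case: (i \in h); case: ifP.
Qed.

Lemma mcoeff_conj_mesym (R : comNzRingType) mu : is_partition mu ->
  (conj_mesym R mu)@_mu = 1.
Proof.
move=> pmu; have lekn j : (conjp mu j <= n)%N by rewrite /conjp -[leqRHS]card_ord max_card.
(* [mu] is the sum of the indicators of its columns. These are initial segments, hence the leading
   exponents of the factors, so the coefficient is a product of leading coefficients. *)
have {1}-> : mu = (\sum_(j <- iota 1 (maxpart mu)) mlead (mesym n R (conjp mu j)))%MM.
  apply/mnmP => i; rewrite mnm_sumE.
  under eq_bigr => j _ do rewrite mlead_mesym // mnmE -mem_level //.
  have := sum_level mu (pred1 i); rewrite big_pred1_eq => ->.
  apply: eq_bigr => j _; have [il|nil] := boolP (i \in level mu j).
    rewrite /= -[RHS](cards1 i); apply: eq_card => a; rewrite !inE andbC.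
    by case: eqP => // ->; rewrite inE in il.
  rewrite /=; apply: eq_card0 => a; rewrite !inE andbC.
  by case: eqP => //= ->; rewrite inE in nil; exact: negPf.
rewrite /conj_mesym mleadc_prod big1 // => j _; exact: mleadc_mesym.
Qed.

Lemma conj_mesym_sym (R : comNzRingType) mu : conj_mesym R mu \is symmetric.
Proof. by apply: rpred_prod => j _; exact: mesym_sym. Qed.

Lemma conj_mesym_expand mu : is_partition mu ->
  exists b : 'X_{1..n} -> Kqt, conj_mesym Kqt mu = monsym mu +
    \sum_(la : 'X_{1..n < (mdeg mu).+1}
            | [&& is_partition la, dominated la mu & bmnm la != mu]) b la *: monsym la.
Proof.
move=> pmu; exists (fun la => (conj_mesym Kqt mu)@_la).
have sz : (msize (conj_mesym Kqt mu) <= (mdeg mu).+1)%N.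
  rewrite mmeasureE; apply/bigmax_leqP_seq => m ms _.
  by have /andP[/eqP <- _] := msupp_conj_mesym pmu ms.
rewrite {1}(sym_monsymE (conj_mesym_sym _ _) sz).
rewrite (bigD1 (BMultinom (ltnSn (mdeg mu)))) //= mcoeff_conj_mesym // scale1r.
congr (_ + _); rewrite big_mkcond [RHS]big_mkcond /=; apply: eq_bigr => la _.
rewrite -val_eqE /=; case: (is_partition la) => //=.
have [|nla] := boolP (bmnm la \in msupp (conj_mesym Kqt mu)).
  by move=> /(msupp_conj_mesym pmu) ->.
move: nla; rewrite -mcoeff_eq0 => /eqP ->; rewrite scale0r.
by case: (_ != _); case: (dominated _ _).
Qed.

End ElementaryProducts.

(** * Linear subspaces and unitriangular families *)

Definition lin_closed n (W : {mpoly Kqt[n]} -> Prop) :=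
  W 0 /\ forall (u : Kqt) f g, W f -> W g -> W (u *: f + g).

Lemma lin_closed_sum n (W : {mpoly Kqt[n]} -> Prop) (J : finType) (P : pred J)
    (a : J -> Kqt) (F : J -> {mpoly Kqt[n]}) :
  lin_closed W -> (forall j, P j -> W (F j)) -> W (\sum_(j | P j) a j *: F j).
Proof.
move=> [W0 WL] WF; apply: (big_rec W) => // j f Pj Wf.
by apply: WL => //; exact: WF.
Qed.

Section Triangular.
Variables (n : nat) (ord : 'X_{1..n} -> 'X_{1..n} -> bool).
Hypotheses
  (ord_irr : forall la, is_partition la -> ~~ ord la la)
  (ord_trans : forall a b c, is_partition a -> is_partition b -> is_partition c ->
      ord a b -> ord b c -> ord a c)
  (ord_size : forall a b, is_partition a -> is_partition b ->
      (mdeg a < mdeg b)%N -> ord a b).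
Implicit Types (la mu : 'X_{1..n}) (B : 'X_{1..n} -> {mpoly Kqt[n]}).

Lemma ord_mdeg la mu : is_partition la -> is_partition mu -> ord la mu ->
  (mdeg la <= mdeg mu)%N.
Proof.
move=> pla pmu lt; rewrite leqNgt; apply/negP => gt; have /negP := ord_irr pla; apply.
exact: (ord_trans pla pmu pla lt (ord_size pmu pla gt)).
Qed.

(** Bounding the degree loses no lower term: by [ord_mdeg] a partition below [mu] has no larger
    degree. *)
Definition unitriangular B := forall mu, is_partition mu ->
  exists a : 'X_{1..n} -> Kqt,
    B mu = monsym mu + \sum_(la : 'X_{1..n < (mdeg mu).+1}
                              | is_partition la && ord la mu) a la *: monsym la.

(* Well-founded induction: below a given degree there are finitely many partitions. *)
Lemma lin_closed_monsym (W : {mpoly Kqt[n]} -> Prop) B mu :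
    lin_closed W -> unitriangular B -> is_partition mu ->
    (forall la, is_partition la -> ord la mu -> W (B la)) ->
  forall la, is_partition la -> ord la mu -> W (monsym la).
Proof.
move=> Wlin Btri pmu WB la.
pose below la := [set ka : 'X_{1..n < (mdeg mu).+1} | is_partition ka && ord ka la].
have [N] := ubnP #|below la|; elim: N la => // N IH la ltN pla la_mu.
have [a Ba] := Btri la pla.
have -> : monsym la = (-1) *: (\sum_(ka : 'X_{1..n < (mdeg la).+1}
     | is_partition ka && ord ka la) a ka *: monsym ka) + B la.
  by rewrite Ba scaleN1r addrC addrK.
apply: Wlin.2; last exact: WB.
apply: lin_closed_sum => // ka /andP[pka ka_la].
have ka_mu := ord_trans pka pla pmu ka_la la_mu.
rewrite ltnS in ltN; apply: IH => //; apply: leq_trans ltN; apply: proper_card.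
apply/properP; split.
  apply/subsetP => x; rewrite !inE => /andP[px x_ka]; rewrite px.
  exact: (ord_trans px pka pla x_ka ka_la).
have lt_ka : (mdeg ka < (mdeg mu).+1)%N by rewrite ltnS ord_mdeg.
exists (BMultinom lt_ka); rewrite !inE /= pka //.
by rewrite negb_and ord_irr ?orbT.
Qed.

(** The two leading terms [monsym mu] cancel, leaving only terms strictly below [mu]. *)
Lemma lin_closed_unitriangular_sub (W : {mpoly Kqt[n]} -> Prop) B B' mu :
    lin_closed W -> unitriangular B -> unitriangular B' -> is_partition mu ->
    (forall la, is_partition la -> ord la mu -> W (B la)) ->
  W (B' mu - B mu).
Proof.
move=> Wlin Btri B'tri pmu WB.
have Wm := lin_closed_monsym Wlin Btri pmu WB.
have [a ->] := Btri mu pmu; have [a' ->] := B'tri mu pmu.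
rewrite opprD addrACA subrr add0r addrC -scaleN1r.
by apply: Wlin.2; apply: lin_closed_sum => // la /andP[pla lamu]; apply: Wm.
Qed.

Lemma lin_closed_unitriangular (W : {mpoly Kqt[n]} -> Prop) B B' mu :
    lin_closed W -> unitriangular B -> unitriangular B' -> is_partition mu ->
    (forall la, is_partition la -> (la == mu) || ord la mu -> W (B la)) ->
  W (B' mu).
Proof.
move=> Wlin Btri B'tri pmu WB; rewrite -(subrK (B mu) (B' mu)) -[_ - _]scale1r.
apply: Wlin.2; last by apply: WB; rewrite ?eqxx.
apply: (lin_closed_unitriangular_sub Wlin Btri B'tri pmu) => la pla la_mu.
by apply: WB; rewrite // la_mu orbT.
Qed.

Lemma unitriangular_sym B mu : unitriangular B -> is_partition mu -> B mu \is symmetric.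
Proof.
move=> Btri /Btri[a ->]; rewrite rpredD ?monsym_sym //.
by apply: rpred_sum => la _; rewrite rpredZ ?monsym_sym.
Qed.

Hypothesis ord_dom : forall a b, is_partition a -> is_partition b ->
      dominated a b -> a != b -> ord a b.

Lemma dominance_unitriangular B :
    (forall mu, is_partition mu -> exists b : 'X_{1..n} -> Kqt,
        B mu = monsym mu + \sum_(la : 'X_{1..n < (mdeg mu).+1}
             | [&& is_partition la, dominated la mu & bmnm la != mu]) b la *: monsym la) ->
  unitriangular B.
Proof.
move=> Bdom mu pmu; have [b ->] := Bdom mu pmu.
(* Coefficients are extended by zero to partitions that are below [mu] for [ord] but not for
   dominance. *)
exists (fun la => if dominated la mu && (la != mu) then b la else 0); congr (_ + _).
rewrite big_mkcond [RHS]big_mkcond; apply: eq_bigr => la _ /=.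
have [pla|] //= := boolP (is_partition la).
case: ifP => [/andP[dla nla]|]; first by rewrite ord_dom.
by rewrite scale0r if_same.
Qed.

End Triangular.

(** * [Dmu] and the homomorphism [D] on products of elementary symmetric polynomials *)

Lemma conjp_bounds n (mu : 'X_{1..n}) j : j \in iota 1 (maxpart mu) ->
  (1 <= conjp mu j <= n)%N.
Proof.
rewrite mem_iota add1n ltnS => /andP[j1 jmax].
rewrite /conjp -[X in (_ <= _ <= X)%N]card_ord max_card andbT card_gt0.
(* If no row had length at least [j], the largest part would be at most [j.-1]. *)
apply/set0Pn; apply/existsP; apply: contraLR jmax; rewrite negb_exists => /forallP nj.
rewrite -ltnNge -(prednK j1) ltnS; apply/bigmax_leqP => i _.
by have := nj i; rewrite inE -ltnNge -{1}(prednK j1) ltnS.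
Qed.

Section DopProducts.
Variable n : nat.
Implicit Types (f g : {mpoly Kqt[n]}) (mu : 'X_{1..n}).

Lemma Dop0 k : Dop k (0 : {mpoly Kqt[n]}) = 0.
Proof.
have sym0 : (0 : {mpoly Kqt[n]}) \is symmetric by exact: rpred0.
(* With scalar -1 and both arguments zero, the right-hand side cancels. *)
by have := Dop_linear k (-1) sym0 sym0; rewrite scaler0 addr0 scaleN1r addNr.
Qed.

Lemma DopZ k (u : Kqt) f : f \is symmetric -> Dop k (u *: f) = u *: Dop k f.
Proof.
move=> symf; have sym0 : (0 : {mpoly Kqt[n]}) \is symmetric by exact: rpred0.
by have := Dop_linear k u symf sym0; rewrite Dop0 !addr0.
Qed.

Lemma Dmu_linear mu (u : Kqt) f g : f \is symmetric -> g \is symmetric ->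
  Dmu mu (u *: f + g) = u *: Dmu mu f + Dmu mu g.
Proof.
move=> symf symg; have sym_foldr s h : h \is symmetric ->
    foldr (fun j => Dop (conjp mu j)) h s \is symmetric.
  by move=> symh; elim: s => //= j s IH; exact: Dop_sym.
rewrite /Dmu; elim: (iota _ _) => //= j s ->.
by apply: Dop_linear; exact: sym_foldr.
Qed.

(** On a common eigenvector the eigenvalues of the successive factors multiply. *)
Lemma Dmu_eigen mu f (x : 'I_n -> Kqt) : f \is symmetric ->
    (forall k, (1 <= k <= n)%N -> Dop k f = (mesym n Kqt k).@[x] *: f) ->
  Dmu mu f = (conj_mesym Kqt mu).@[x] *: f.
Proof.
move=> symf eigf; rewrite /Dmu /conj_mesym -/(maxpart mu).
have := @conjp_bounds n mu; elim: (iota _ _) => [|j s IH] bnd /=.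
  by rewrite big_nil meval1 scale1r.
rewrite IH => [|i si]; last by apply: bnd; rewrite inE si orbT.
rewrite (DopZ _ _ symf) eigf; last by apply: bnd; rewrite inE eqxx.
by rewrite scalerA big_cons mevalM mulrC.
Qed.

Variable D : {mpoly Kqt[n]} -> {mpoly Kqt[n]} -> {mpoly Kqt[n]}.
Hypotheses
  (D_lin : forall (a : Kqt) g h f, g \is symmetric -> h \is symmetric ->
      f \is symmetric -> D (a *: g + h) f = a *: D g f + D h f)
  (D_mul : forall g h f, g \is symmetric -> h \is symmetric ->
      f \is symmetric -> D (g * h) f = D g (D h f))
  (D_one : forall f, f \is symmetric -> D 1 f = f)
  (D_e : forall k f, (1 <= k <= n)%N -> f \is symmetric ->
      D (mesym n Kqt k) f = Dop k f).

Lemma D_conj_mesym mu f : f \is symmetric -> D (conj_mesym Kqt mu) f = Dmu mu f.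
Proof.
move=> symf; rewrite /Dmu /conj_mesym -/(maxpart mu).
have := @conjp_bounds n mu; elim: (iota _ _) => [|j s IH] bnd /=.
  by rewrite big_nil D_one.
have sym_e : \prod_(i <- s) mesym n Kqt (conjp mu i) \is symmetric.
  by apply: rpred_prod => i _; exact: mesym_sym.
have bnds i : i \in s -> (1 <= conjp mu i <= n)%N.
  by move=> si; apply: bnd; rewrite inE si orbT.
rewrite big_cons (D_mul (mesym_sym _ _ _) sym_e symf) (IH bnds); apply: D_e.
  by apply: bnd; rewrite inE eqxx.
by elim: {IH bnd sym_e bnds} s => //= i s IH; exact: Dop_sym.
Qed.

Lemma D0 f : f \is symmetric -> D 0 f = 0.
Proof.
move=> symf; have sym0 : (0 : {mpoly Kqt[n]}) \is symmetric by exact: rpred0.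
by have := D_lin (-1) sym0 sym0 symf; rewrite scaler0 addr0 scaleN1r addNr.
Qed.

(** [Q] will be an eigenvalue relation or the vanishing of a pairing. Symmetry of [g] is carried
    along because [D_lin] concerns symmetric arguments. *)
Lemma lin_closed_D (f : {mpoly Kqt[n]}) (Q : {mpoly Kqt[n]} -> {mpoly Kqt[n]} -> Prop) :
    f \is symmetric -> Q 0 0 ->
    (forall (u : Kqt) g h g' h', Q g g' -> Q h h' -> Q (u *: g + h) (u *: g' + h')) ->
  lin_closed (fun g => g \is symmetric /\ Q g (D g f)).
Proof.
move=> symf Q0 QL; split=> [|u g h [symg Qg] [symh Qh]].
  by rewrite (D0 symf); split=> //; exact: rpred0.
split; first by apply: rpredD => //; exact: rpredZ.
by rewrite D_lin //; exact: QL.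
Qed.

End DopProducts.

(** * Orthogonality of the interpolation polynomials and the two forms of their norm *)

Theorem theorem2 (n : nat) (hn : (1 <= n)%N)
  (* a total order on partitions compatible with size and dominance *)
  (ord : 'X_{1..n} -> 'X_{1..n} -> bool)
  (ord_irr : forall la, is_partition la -> ~~ ord la la)
  (ord_trans : forall a b c, is_partition a -> is_partition b -> is_partition c ->
      ord a b -> ord b c -> ord a c)
  (ord_total : forall a b, is_partition a -> is_partition b -> a != b ->
      ord a b || ord b a)
  (ord_size : forall a b, is_partition a -> is_partition b ->
      (mdeg a < mdeg b)%N -> ord a b)
  (ord_dom : forall a b, is_partition a -> is_partition b ->
      dominated a b -> a != b -> ord a b)
  (* the algebra homomorphism D : Lambda_n -> End(Lambda_n), D(e_k) = D_k *)
  (D : {mpoly Kqt[n]} -> {mpoly Kqt[n]} -> {mpoly Kqt[n]})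
  (D_lin : forall (a : Kqt) g h f, g \is symmetric -> h \is symmetric ->
      f \is symmetric -> D (a *: g + h) f = a *: D g f + D h f)
  (D_mul : forall g h f, g \is symmetric -> h \is symmetric ->
      f \is symmetric -> D (g * h) f = D g (D h f))
  (D_one : forall f, f \is symmetric -> D 1 f = f)
  (D_e : forall k f, (1 <= k <= n)%N -> f \is symmetric ->
      D (mesym n Kqt k) f = Dop k f)
  (* interpolation polynomials I_mu *)
  (I : 'X_{1..n} -> {mpoly Kqt[n]})
  (I_expand : forall mu, is_partition mu ->
      exists a : 'X_{1..n} -> Kqt,
        I mu = monsym mu + \sum_(la : 'X_{1..n < (mdeg mu).+1}
                                  | is_partition la && ord la mu)
                             a la *: monsym la)
  (I_vanish : forall mu la, is_partition mu -> is_partition la ->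
      ord la mu -> (I mu).@[hat la] = 0)
  (* Macdonald polynomials P_mu *)
  (P : 'X_{1..n} -> {mpoly Kqt[n]})
  (P_eig : forall mu k, is_partition mu -> (1 <= k <= n)%N ->
      Dop k (P mu) = (mesym n Kqt k).@[hat mu] *: P mu)
  (P_expand : forall mu, is_partition mu ->
      exists b : 'X_{1..n} -> Kqt,
        P mu = monsym mu + \sum_(la : 'X_{1..n < (mdeg mu).+1}
                                  | [&& is_partition la, dominated la mu & bmnm la != mu])
                             b la *: monsym la)
  (* the coefficients c_{mu,nu} *)
  (c : 'X_{1..n} -> 'X_{1..n} -> Kqt)
  (c_def : forall mu f, is_partition mu -> f \is symmetric ->
      (Dmu mu f).@[@hat0 n] =
        \sum_(nu : 'X_{1..n < (mdeg mu).+1} | is_partition nu && dominated nu mu)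
           c mu nu * f.@[hat nu])
  (mu nu : 'X_{1..n}) (hmu : is_partition mu) (hnu : is_partition nu) :
  (D (I mu) (I nu)).@[@hat0 n]
    = (mu == nu)%:R * (I mu).@[hat mu] * (P mu).@[@hat0 n]
  /\ (mu == nu)%:R * (I mu).@[hat mu] * (P mu).@[@hat0 n]
    = (mu == nu)%:R * c mu mu * (I mu).@[hat mu].
Proof.
have triI : unitriangular ord I by [].
have triP : unitriangular ord P by apply: dominance_unitriangular.
have triE : unitriangular ord (conj_mesym Kqt).
  by apply: dominance_unitriangular => // la pla; exact: conj_mesym_expand.
have symI la (pla : is_partition la) := unitriangular_sym triI pla.
have symP la (pla : is_partition la) := unitriangular_sym triP pla.
have symE la : conj_mesym Kqt la \is symmetric := conj_mesym_sym _ la.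
have DE ka f : f \is symmetric -> D (conj_mesym Kqt ka) f = Dmu ka f.
  exact: (D_conj_mesym D_mul D_one D_e).
(* The eigenvalue relation holds for the products [conj_mesym] by [Dmu_eigen], and passes to [I mu]
   by triangularity. *)
have DP la : is_partition la -> D (I mu) (P la) = (I mu).@[hat la] *: P la.
  move=> pla; pose W g := g \is symmetric /\ D g (P la) = g.@[hat la] *: P la.
  suff [] : W (I mu) by [].
  apply: (lin_closed_unitriangular ord_irr ord_trans ord_size _ triE triI hmu).
    apply: (lin_closed_D D_lin (Q := fun g h => h = g.@[hat la] *: P la)) => //.
    - exact: symP.
    - by rewrite meval0 scale0r.
    - by move=> u g h _ _ -> ->; rewrite mevalD mevalZ scalerDl scalerA.
  move=> ka pka _; split=> //; rewrite DE; last exact: symP.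
  by apply: Dmu_eigen; [exact: symP | move=> k kn; exact: P_eig].
(* [D_lin] is linearity in the first argument. In the second it comes from [Dmu], since [I mu] is a
   combination of the [conj_mesym]. *)
have DI_linear (u : Kqt) f g : f \is symmetric -> g \is symmetric ->
    D (I mu) (u *: f + g) = u *: D (I mu) f + D (I mu) g.
  move=> symf symg; have symfg : u *: f + g \is symmetric.
    by apply: rpredD => //; exact: rpredZ.
  pose W h := h \is symmetric /\ D h (u *: f + g) = u *: D h f + D h g.
  suff [] : W (I mu) by [].
  apply: (lin_closed_unitriangular ord_irr ord_trans ord_size _ triE triI hmu).
    split=> [|v g1 g2 [sym1 e1] [sym2 e2]].
      by split; [exact: rpred0 | rewrite !(D0 D_lin) // scaler0 addr0].
    split; first by apply: rpredD => //; exact: rpredZ.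
    rewrite !D_lin // e1 e2 !scalerDr !scalerA (mulrC v u) -!addrA.
    by congr (_ + _); rewrite addrCA.
  by move=> ka pka _; split=> //; rewrite !DE // Dmu_linear.
have linI : lin_closed (fun f => f \is symmetric /\ (D (I mu) f).@[@hat0 n] = 0).
  have sym0 : (0 : {mpoly Kqt[n]}) \is symmetric by exact: rpred0.
  split=> [|u f g [symf f0] [symg g0]].
    by split=> //; have := DI_linear (-1) 0 0 sym0 sym0;
      rewrite scaler0 addr0 scaleN1r addNr => ->; rewrite meval0.
  split; first by apply: rpredD => //; exact: rpredZ.
  by rewrite DI_linear // mevalD mevalZ f0 g0 mulr0 addr0.
have linE ka : is_partition ka ->
    lin_closed (fun g => g \is symmetric /\ (D g (I ka)).@[@hat0 n] = 0).
  move=> pka; apply: (lin_closed_D D_lin (Q := fun _ h => h.@[@hat0 n] = 0)).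
  - exact: symI.
  - by rewrite meval0.
  - by move=> u g h g' h' g0 h0; rewrite mevalD mevalZ g0 h0 mulr0 addr0.
(* Every point in the expansion [c_def] is indexed by a partition dominated by [la], hence below
   [ka], where [I ka] vanishes. *)
have E_vanish la ka : is_partition la -> is_partition ka -> ord la ka ->
    (D (conj_mesym Kqt la) (I ka)).@[@hat0 n] = 0.
  move=> pla pka la_ka; rewrite DE ?c_def ?symI //.
  rewrite big1 // => x /andP[px xla]; rewrite I_vanish ?mulr0 //.
  have [-> //|nx] := eqVneq (bmnm x) la.
  by apply: (ord_trans _ la) => //; exact: ord_dom.
have P_vanish la : is_partition la -> ord la mu -> (D (I mu) (P la)).@[@hat0 n] = 0.
  by move=> pla la_mu; rewrite DP // mevalZ I_vanish // mul0r.
have [eq_mn|ne_mn] := eqVneq mu nu; last first.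
  (* If [mu] is below [nu], expand [I mu] in the [conj_mesym]; otherwise expand [I nu] in the [P].
     All terms, the leading one included, pair to zero. *)
  rewrite !mul0r; split=> //; have /orP[lt|gt] := ord_total _ _ hmu hnu ne_mn.
  - have [//|_ -> //] :=
      lin_closed_unitriangular ord_irr ord_trans ord_size (linE _ hnu) triE triI hmu _.
    move=> la pla la_mu; split=> //; apply: E_vanish => //.
    by case/orP: la_mu => [/eqP -> //|la_mu]; exact: (ord_trans _ mu).
  - have [//|_ -> //] :=
      lin_closed_unitriangular ord_irr ord_trans ord_size linI triP triI hnu _.
    move=> la pla la_nu; split; first exact: symP.
    apply: P_vanish => //.
    by case/orP: la_nu => [/eqP -> //|la_nu]; exact: (ord_trans _ nu).
rewrite -eq_mn !mul1r.
(* [I mu - P mu] is a combination of strictly lower [P la], which pair to zero with [I mu]; only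
   [P mu] contributes. *)
have byP : (D (I mu) (I mu)).@[@hat0 n] = (I mu).@[hat mu] * (P mu).@[@hat0 n].
  have [|sym_d d0] :=
    lin_closed_unitriangular_sub ord_irr ord_trans ord_size linI triP triI hmu _.
    by move=> la pla la_mu; split; [exact: symP | exact: P_vanish].
  rewrite -[X in D _ X](subrK (P mu)) -[_ - _]scale1r DI_linear //; last exact: symP.
  by rewrite mevalD mevalZ d0 mulr0 add0r DP // mevalZ.
have byE : (D (I mu) (I mu)).@[@hat0 n] = c mu mu * (I mu).@[hat mu].
  have [|sym_d d0] :=
    lin_closed_unitriangular_sub ord_irr ord_trans ord_size (linE _ hmu) triE triI hmu _.
    by move=> la pla la_mu; split=> //; exact: E_vanish.
  rewrite -[X in D X _](subrK (conj_mesym Kqt mu)) -[_ - _]scale1r D_lin //; last exact: symI.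
  rewrite mevalD mevalZ d0 mulr0 add0r DE ?c_def ?symI //.
  (* Apart from [mu] itself, the sum runs over partitions strictly below [mu], where [I mu]
     vanishes. *)
  rewrite (bigD1 (BMultinom (ltnSn (mdeg mu)))) /=; last first.
    by rewrite hmu /dominated eqxx; apply/forallP.
  rewrite big1 ?addr0 // => x /andP[/andP[px xmu]]; rewrite -val_eqE /= => nx.
  by rewrite I_vanish ?mulr0 //; exact: ord_dom.
by split; rewrite -?byP // byE.
Qed.
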